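(* Let $k\ge5$ and let $C_k$ be the cycle with vertex set $V=\{0,1,\dots,k-1\}$ and $i\sim j$ if and only if $i-j\equiv\pm1\pmod k$, with edge weight $w\equiv1$. For any $m_0:V\to\mathbb{R}_+$, the solution $m:[0,\infty)\times V\to\mathbb{R}_+$ to the Bakry-Émery Ricci flow (with $n=\infty$) $$\partial_t m(t,i)=-\mathrm{Ric}_{m(t,\cdot)}(i),\qquad m(0,i)=m_0(i),\qquad i\in V,$$ converges as $t\to\infty$ to a constant weight: there is a constant $c>0$ such that $\lim_{t\to\infty}m(t,i)=c$ for every $i\in V$.
   Context: $\mathbb{R}_+=(0,\infty)$. Write $y\sim x$ if $\{x,y\}$ is an edge. For a vertex weight $m:V\to\mathbb{R}_+$ (edge weight $\equiv1$) and $f,g:V\to\mathbb{R}$ define $$\Delta f(x)=\frac{1}{m(x)}\sum_{y\sim x}(f(y)-f(x)),\qquad \Gamma(f,g)=\tfrac12\big(\Delta(fg)-f\Delta g-g\Delta f\big),$$ $$\Gamma(f)=\Gamma(f,f),\qquad \Gamma_2(f)=\tfrac12\Delta\Gamma(f)-\Gamma(\Delta f,f).$$ The ($\infty$-dimensional) Bakry-Émery curvature $\mathrm{Ric}_m(x)$ is the maximal $K\in\mathbb{R}$ such that $\Gamma_2(f)(x)\ge K\,\Gamma(f)(x)$ for all $f:V\to\mathbb{R}$. *)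

(* Defs.v *)
From HB Require Import structures.
From mathcomp Require Import all_boot all_order all_algebra.
From mathcomp Require Import all_classical all_reals all_analysis.
Import Order.TTheory GRing.Theory Num.Theory.
Import numFieldNormedType.Exports.

Set Implicit Arguments.
Unset Strict Implicit.
Unset Printing Implicit Defensive.

Local Open Scope classical_set_scope.
Local Open Scope ring_scope.

Section BakryEmery.
Variables (R : realType) (V : finType) (e : rel V).
Implicit Types (m f g : V -> R) (x : V) (K : R).

Definition Laplacian m f : V -> R :=
  fun x => (m x)^-1 * \sum_(y | e x y) (f y - f x).

Definition Gamma m f g : V -> R := fun x =>
  2^-1 * (Laplacian m (fun y => f y * g y) x
          - f x * Laplacian m g x - g x * Laplacian m f x).

Definition Gamma2 m f : V -> R := fun x =>
  2^-1 * Laplacian m (Gamma m f f) x - Gamma m (Laplacian m f) f x.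

Definition curvature_bounds m x : set R :=
  [set K | forall f : V -> R, K * Gamma m f f x <= Gamma2 m f x].

(* The set of lower curvature bounds is closed, so its supremum is its maximum
   as soon as it is nonempty and bounded above; see [Ric_max] for the
   agreement with "the maximal K". *)
Definition Ric m x : R := sup (curvature_bounds m x).

Lemma Ric_max m x K :
  curvature_bounds m x K -> ubound (curvature_bounds m x) K -> Ric m x = K.
Proof.
move=> mK ubK; apply/eqP; rewrite eq_le; apply/andP; split.
  by apply: ge_sup => //; exists K.
by apply: ub_le_sup => //; exists K.
Qed.

(* [m t] is only meaningful for t >= 0. The difference quotient is restricted
   to times s >= 0, s != t: this is the usual derivative for t > 0 and the
   right derivative for t = 0. *)
Definition Ricci_flow (m0 : V -> R) (m : R -> V -> R) : Prop :=
  [/\ forall (t : R) x, 0 <= t -> 0 < m t x,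
      forall x, m 0 x = m0 x
    & forall (t : R) x, 0 <= t ->
        (m s x - m t x) / (s - t) @[s --> within [set s | 0 <= s] t^']
          --> - Ric (m t) x].

End BakryEmery.

Definition cycle_adj (k : nat) : rel 'I_k := fun i j =>
  ((i%:Z - j%:Z == 1 %[mod k])%Z || (i%:Z - j%:Z == - 1 %[mod k])%Z).

(* Main.v *)
(* With r, p, q the inverse weights of a vertex of the cycle and of its two
   neighbours, the curvature at that vertex is the least eigenvalue of
   [[p, r], [r, q]]. It is nonnegative at a maximum and nonpositive at a minimum
   of the weight, so along the flow the weights stay between min m0 and max m0.
   On this box the equation is Lipschitz: Picard iteration, applied after
   clamping the weights to the box, gives a global solution, and it is unique.
   The flow is moreover a discrete diffusion with coefficients bounded below by a
   positive constant, hence after time k the minimum has increased by at least a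
   fixed fraction of max m - min m. Since the minimum is monotone and bounded, it
   converges and the oscillation tends to 0. *)

Require Import Defs.
From mathcomp Require Import all_boot all_order all_algebra.
From mathcomp Require Import all_classical all_reals all_analysis.
From mathcomp Require Import zify ring lra.
Import Order.TTheory GRing.Theory Num.Theory.
Import numFieldNormedType.Exports.
Local Open Scope classical_set_scope.
Local Open Scope ring_scope.

(** * Curvature of weighted cycles *)

Section CycleCurvature.
Context {R : realType}.
Implicit Types (p q r : R).

Lemma val_ordS (k : nat) (i : 'I_k) :
  ordS i = (if i.+1 == k then 0 else i.+1) :> nat.
Proof.
have ik := ltn_ord i; rewrite /=; case: eqP => [->|]; first exact: modnn.
by move=> neq; rewrite modn_small//; lia.
Qed.

Lemma val_ord_pred (k : nat) (i : 'I_k) :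
  ord_pred i = (if i == 0 :> nat then k.-1 else i.-1) :> nat.
Proof.
have ik := ltn_ord i; rewrite /=; case: eqP => [->|neq].
  by rewrite modn_small//; lia.
have -> : ((i + k).-1 = i.-1 + k)%N by lia.
by rewrite modnDr modn_small//; lia.
Qed.

Let ord_eqE (k : nat) (x y : 'I_k) : (x == y) = (x == y :> nat).
Proof. by []. Qed.

Lemma cycle_adjE (k : nat) (i j : 'I_k) : (3 <= k)%N ->
  cycle_adj i j = (j == ordS i) || (j == ord_pred i).
Proof.
move=> k3; have ik := ltn_ord i; have jk := ltn_ord j.
rewrite /cycle_adj !eqz_mod_dvd !ord_eqE val_ordS val_ord_pred orbC.
congr (_ || _); apply/idP/idP.
- case/dvdzP => z; case: (ltgtP z 0) => hz; last by subst z; case: ifP; lia.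
  + have {}hz : z <= -1 by lia.
    case: ifP; nia.
  + have {}hz : 1 <= z by lia.
    case: ifP; nia.
- move=> /eqP ->; case: ifP => /eqP h; apply/dvdzP.
  + by exists 1; lia.
  + by exists 0; lia.
- case/dvdzP => z; case: (ltgtP z 0) => hz; last by subst z; case: ifP; lia.
  + have {}hz : z <= -1 by lia.
    case: ifP; nia.
  + have {}hz : 1 <= z by lia.
    case: ifP; nia.
- move=> /eqP ->; case: ifP => /eqP h; apply/dvdzP.
  + by exists (-1); lia.
  + by exists 0; lia.
Qed.

Lemma cycle_sum (k : nat) (i : 'I_k) (g : 'I_k -> R) : (3 <= k)%N ->
  \sum_(j | cycle_adj i j) g j = g (ordS i) + g (ord_pred i).
Proof.
move=> k3; under eq_bigl do rewrite cycle_adjE//.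
have neq : ord_pred i != ordS i.
  rewrite ord_eqE val_ordS val_ord_pred; have := ltn_ord i.
  by case: ifP; case: ifP; lia.
rewrite (bigD1 (ordS i)) ?eqxx//= (bigD1 (ord_pred i)) ?eqxx ?orbT//=.
rewrite big1 ?addr0// => j /andP[/andP[/orP[/eqP->|/eqP->]]].
  by rewrite eqxx.
by rewrite eqxx ?andbF.
Qed.

Lemma Gamma_cycle (k : nat) (m f : 'I_k -> R) (i : 'I_k) : (3 <= k)%N ->
  Gamma (@cycle_adj k) m f f i =
  (2 * m i)^-1 * ((f (ordS i) - f i) ^+ 2 + (f (ord_pred i) - f i) ^+ 2).
Proof.
by move=> k3; rewrite /Gamma /Laplacian !cycle_sum// invfM; ring.
Qed.

Lemma Gamma2_cycle (k : nat) (m f : 'I_k -> R) (i : 'I_k) : (3 <= k)%N ->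
  let a := f (ordS i) - f i in
  let b := f (ord_pred i) - f i in
  let c := f (ordS (ordS i)) - f (ordS i) in
  let d := f (ord_pred (ord_pred i)) - f (ord_pred i) in
  Gamma2 (@cycle_adj k) m f i =
  (2 * m i)^-1 * ((m (ordS i))^-1 * (a ^+ 2 + (c - a) ^+ 2 / 2)
                + (m (ord_pred i))^-1 * (b ^+ 2 + (d - b) ^+ 2 / 2)
                + 2 * (m i)^-1 * a * b).
Proof.
move=> k3 a b c d; rewrite /Gamma2 [in LHS]/Laplacian !cycle_sum//.
rewrite !Gamma_cycle// /Gamma /Laplacian !cycle_sum//= !ordSK !ord_predK.
rewrite /a /b /c /d !invfM.
move: (m i)^-1 (m (ordS i))^-1 (m (ord_pred i))^-1 => r p q; by field.
Qed.

(* The least eigenvalue of the symmetric matrix [[p, r], [r, q]]. *)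
Definition min_eigen p r q : R :=
  (p + q) / 2 - Num.sqrt (((p - q) / 2) ^+ 2 + r ^+ 2).

Lemma min_eigen_root p r q (l := min_eigen p r q) :
  (p - l) * (q - l) = r ^+ 2.
Proof.
have s2 : Num.sqrt (((p - q) / 2) ^+ 2 + r ^+ 2) ^+ 2 =
    ((p - q) / 2) ^+ 2 + r ^+ 2.
  by rewrite sqr_sqrtr// addr_ge0// sqr_ge0.
rewrite /l /min_eigen; move: s2; set s := Num.sqrt _ => s2.
have -> : r ^+ 2 = s ^+ 2 - ((p - q) / 2) ^+ 2 by rewrite s2; ring.
by field.
Qed.

Lemma min_eigen_lt p r q : 0 < r -> min_eigen p r q < p.
Proof.
move=> r0; rewrite /min_eigen.
have : `|(p - q) / 2| < Num.sqrt (((p - q) / 2) ^+ 2 + r ^+ 2).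
  by rewrite -sqrtr_sqr ltr_sqrt ?ltrDl ?exprn_gt0// ltr_wpDl ?sqr_ge0 ?exprn_gt0.
by rewrite ltr_norml => /andP[h1 h2]; lra.
Qed.

Lemma min_eigen_form p r q a b : 0 < r ->
  min_eigen p r q * (a ^+ 2 + b ^+ 2) <= p * a ^+ 2 + q * b ^+ 2 + 2 * r * a * b.
Proof.
move=> r0; have := min_eigen_root p r q; have := @min_eigen_lt p r q r0.
move: (min_eigen p r q) => l lp root; rewrite -subr_ge0.
have pl : 0 < p - l by rewrite subr_gt0.
rewrite -(pmulr_rge0 _ pl).
rewrite [X in 0 <= X](_ : _ = ((p - l) * a + r * b) ^+ 2
                     + ((p - l) * (q - l) - r ^+ 2) * b ^+ 2); last by ring.
by rewrite root subrr mul0r addr0 sqr_ge0.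
Qed.

(* Since k >= 5 the second neighbours of i are distinct from each other and from
   the first ones, so the values of f there are free; the best choice continues
   f linearly, which leaves the quadratic form [[p, r], [r, q]]. *)
Lemma Ric_cycle (k : nat) (m : 'I_k -> R) (i : 'I_k) : (5 <= k)%N ->
  (forall j, 0 < m j) ->
  Ric (@cycle_adj k) m i =
  min_eigen (m (ordS i))^-1 (m i)^-1 (m (ord_pred i))^-1.
Proof.
move=> k5 m0; have k3 : (3 <= k)%N by lia.
have mi2 : 0 < (2 * m i)^-1 by rewrite invr_gt0 mulr_gt0.
apply: Ric_max => [f|K Kbound].
  rewrite Gamma_cycle// Gamma2_cycle// mulrCA ler_pM2l//.
  apply: le_trans (@min_eigen_form _ _ _ _ _ _) _; first by rewrite invr_gt0.
  rewrite lerD2r lerD// ler_pM2l ?invr_gt0// lerDl divr_ge0 ?sqr_ge0//.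
set p := (m (ordS i))^-1; set r := (m i)^-1; set q := (m (ord_pred i))^-1.
have r0 : 0 < r by rewrite invr_gt0.
have := min_eigen_root p r q; have := @min_eigen_lt p r q r0.
move: (min_eigen p r q) => l lp root.
pose f (j : 'I_k) : R :=
  if j == ordS i then r else if j == ord_pred i then l - p else
  if j == ordS (ordS i) then 2 * r else
  if j == ord_pred (ord_pred i) then 2 * (l - p) else 0.
have : uniq [:: i; ordS i; ord_pred i; ordS (ordS i); ord_pred (ord_pred i)].
  have ik := ltn_ord i.
  rewrite /= !inE !negb_or !ord_eqE !(val_ordS, val_ord_pred).
  case: (i.+1 =P k) => ?; case: (i =P 0 :> nat) => ? /=; do ?case: ifP; lia.
rewrite /= !inE !negb_or -!andbA !andbT.
case/and5P => /negPf n1 /negPf n2 /negPf n3 /negPf n4.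
case/and5P => /negPf n5 /negPf n6 /negPf n7 /negPf n8 /andP[/negPf n9 /negPf n10].
have f0 : f i = 0 by rewrite /f n1 n2 n3 n4.
have f1 : f (ordS i) = r by rewrite /f eqxx.
have f2 : f (ord_pred i) = l - p by rewrite /f eq_sym n5 eqxx.
have f3 : f (ordS (ordS i)) = 2 * r.
  by rewrite /f eq_sym n6 eq_sym n8 eqxx.
have f4 : f (ord_pred (ord_pred i)) = 2 * (l - p).
  by rewrite /f eq_sym n7 eq_sym n9 eq_sym n10 eqxx.
have := Kbound f; rewrite Gamma_cycle// Gamma2_cycle// f0 f1 f2 f3 f4.
rewrite mulrCA ler_pM2l// -/p -/q -/r !subr0.
have pos : 0 < r ^+ 2 + (l - p) ^+ 2.
  by rewrite ltr_pwDl ?sqr_ge0// exprn_gt0.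
rewrite [X in _ <= X -> _](_ : _ = l * (r ^+ 2 + (l - p) ^+ 2)
     + (l - p) * ((p - l) * (q - l) - r ^+ 2) * -1 ); last first.
  by field.
rewrite root subrr mulr0 mul0r addr0 ler_pM2r//.
Qed.

Lemma min_eigen_ge0 p r q : 0 < r -> r <= p -> r <= q -> 0 <= min_eigen p r q.
Proof.
move=> r0 rp rq; rewrite /min_eigen subr_ge0.
rewrite -(@ger0_norm _ ((p + q) / 2)); last by lra.
rewrite -sqrtr_sqr ler_sqrt ?sqr_ge0//; nra.
Qed.

Lemma min_eigen_le0 p r q : 0 < p -> 0 < q -> p <= r -> q <= r ->
  min_eigen p r q <= 0.
Proof.
move=> p0 q0 pr qr; rewrite /min_eigen subr_le0.
rewrite -(@ger0_norm _ ((p + q) / 2)); last by lra.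
by rewrite -sqrtr_sqr ler_sqrt ?addr_ge0 ?sqr_ge0//; nra.
Qed.

Lemma sqrt_sum_sqr_lip (a b c d : R) :
  Num.sqrt (a ^+ 2 + b ^+ 2) <= Num.sqrt (c ^+ 2 + d ^+ 2) + `|a - c| + `|b - d|.
Proof.
have s0 : 0 <= Num.sqrt (c ^+ 2 + d ^+ 2) by exact: sqrtr_ge0.
have s2 : Num.sqrt (c ^+ 2 + d ^+ 2) ^+ 2 = c ^+ 2 + d ^+ 2.
  by rewrite sqr_sqrtr// addr_ge0// sqr_ge0.
move: s0 s2; set s := Num.sqrt (c ^+ 2 + _) => s0 s2.
have cs : `|c| <= s.
  by rewrite -(ler_pXn2r (n := 2))// ?nnegrE// s2 real_normK ?num_real// lerDl sqr_ge0.
have ds : `|d| <= s.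
  by rewrite -(ler_pXn2r (n := 2))// ?nnegrE// s2 real_normK ?num_real// lerDr sqr_ge0.
have u0 := normr_ge0 (a - c); have v0 := normr_ge0 (b - d).
have ts : 0 <= s + `|a - c| + `|b - d| by lra.
rewrite -(ger0_norm ts) -sqrtr_sqr ler_sqrt ?sqr_ge0//.
have E1 : a ^+ 2 <= c ^+ 2 + 2 * s * `|a - c| + `|a - c| ^+ 2.
  have -> : a ^+ 2 = c ^+ 2 + 2 * (c * (a - c)) + `|a - c| ^+ 2.
    by rewrite real_normK ?num_real//; ring.
  have : c * (a - c) <= s * `|a - c|.
    by rewrite (le_trans (ler_norm _))// normrM ler_wpM2r.
  lra.
have E2 : b ^+ 2 <= d ^+ 2 + 2 * s * `|b - d| + `|b - d| ^+ 2.
  have -> : b ^+ 2 = d ^+ 2 + 2 * (d * (b - d)) + `|b - d| ^+ 2.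
    by rewrite real_normK ?num_real//; ring.
  have : d * (b - d) <= s * `|b - d|.
    by rewrite (le_trans (ler_norm _))// normrM ler_wpM2r.
  lra.
have uv : 0 <= `|a - c| * `|b - d| by rewrite mulr_ge0.
move: E1 E2 s2 uv; set u := `|a - c|; set v := `|b - d|; nra.
Qed.

Lemma min_eigen_lip p r q p' r' q' :
  min_eigen p r q <= min_eigen p' r' q' + `|p - p'| + `|r - r'| + `|q - q'|.
Proof.
rewrite /min_eigen.
have := sqrt_sum_sqr_lip ((p' - q') / 2) r' ((p - q) / 2) r.
set s := Num.sqrt _; set s' := Num.sqrt _.
rewrite (distrC r') (_ : (p' - q') / 2 - _ = ((q - q') - (p - p')) / 2); last by field.
rewrite normrM (@ger0_norm _ 2^-1) ?invr_ge0//.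
have := ler_normB (q - q') (p - p'); have := ler_norm (p - p').
have := ler_norm (q - q').
move: `|p - p'| `|q - q'| `|r - r'| => P Q RR.
set N := `|_|; lra.
Qed.

End CycleCurvature.

(** * Derivatives and a maximum principle *)

Section Derivatives.
Context {R : realType}.
Implicit Types (f : R -> R) (t l : R).

Lemma quotient_dist f l t s : s != t ->
  `|l - (f s - f t) / (s - t)| * `|s - t| = `|f s - f t - l * (s - t)|.
Proof.
move=> st; rewrite -normrM distrC; congr `|_|.
by rewrite mulrBl divfK// subr_eq0.
Qed.

Lemma is_deriveP f t l :
  is_derive t 1 f l <->
  forall e, 0 < e -> exists2 d, 0 < d & forall s, `|s - t| < d ->
    `|f s - f t - l * (s - t)| <= e * `|s - t|.
Proof.
have E : (h^-1 *: (f (h *: 1 + t) - f t) @[h --> (0 : R)^'] --> l) <->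
    (forall e, 0 < e -> exists2 d, 0 < d & forall s, `|s - t| < d ->
    `|f s - f t - l * (s - t)| <= e * `|s - t|).
  rewrite cvgrPdist_le; split => H e e0.
    have /nbhs_ballP[d /= d0 hd] := H e e0; exists d => // s sd.
    have [->|st] := eqVneq s t; first by rewrite !subrr mulr0 subrr normr0 mulr0.
    rewrite -quotient_dist// ler_wpM2r//.
    have := hd (s - t); rewrite /ball/= sub0r normrN => /(_ sd).
    by rewrite subr_eq0 st => /(_ isT); rewrite scaler1 subrK /GRing.scale/= mulrC.
  have [d d0 hd] := H e e0; apply/nbhs_ballP; exists d => //= h.
  rewrite /ball/= sub0r normrN => hd0 h0.
  have {}hd : `|f (h + t) - f t - l * h| <= e * `|h|.
    by have := hd (h + t); rewrite addrK; apply.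
  rewrite scaler1 /GRing.scale/= mulrC -(@ler_pM2r _ `|h|) ?normr_gt0//.
  by rewrite -normrM mulrBl divfK// distrC.
split=> [[c dl]|/(proj2 E) c]; last exact: DeriveDef (cvgP _ c) (cvg_lim _ c).
by apply: (proj1 E); rewrite -dl; exact: c.
Qed.

Lemma cvg_quotient_within (A : set R) f t l :
  (f s - f t) / (s - t) @[s --> within A t^'] --> l <->
  forall e, 0 < e -> exists2 d, 0 < d & forall s, A s -> `|s - t| < d ->
    `|f s - f t - l * (s - t)| <= e * `|s - t|.
Proof.
rewrite cvgrPdist_le; split => H e e0.
  have /nbhs_ballP[d /= d0 hd] := H e e0; exists d => // s As sd.
  have [->|st] := eqVneq s t; first by rewrite !subrr mulr0 subrr normr0 mulr0.
  rewrite -quotient_dist// ler_wpM2r//.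
  by have := hd s; rewrite /ball/= distrC => /(_ sd st As).
have [d d0 hd] := H e e0; apply/nbhs_ballP; exists d => //= s.
rewrite /ball/= distrC => sd st As.
by rewrite -(@ler_pM2r _ `|s - t|) ?normr_gt0 ?subr_eq0// quotient_dist// hd.
Qed.

Lemma is_derive_cvg_quotient (A : set R) f t l : is_derive t 1 f l ->
  (f s - f t) / (s - t) @[s --> within A t^'] --> l.
Proof.
move/is_deriveP => H; apply/cvg_quotient_within => e /H[d d0 hd].
by exists d => // s _; exact: hd.
Qed.

(* Gluing its tangent at 0 to the left turns a function which is differentiable
   on [0, +oo[ in the one-sided sense into one with two-sided derivatives. *)
Definition tangent_extension f l : R -> R :=
  fun t => if t < 0 then f 0 + t * l else f t.

Lemma tangent_extension_derive f (df : R -> R) :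
  (forall t, 0 <= t ->
    (f s - f t) / (s - t) @[s --> within [set s | 0 <= s] t^'] --> df t) ->
  forall t, 0 <= t -> is_derive t 1 (tangent_extension f (df 0)) (df t).
Proof.
move=> H t t0; apply/is_deriveP => e e0.
have /cvg_quotient_within/(_ e e0)[d d0 hd] := H t t0.
rewrite /tangent_extension [t < 0]ltNge t0/=.
move: t0; rewrite le_eqVlt => /predU1P[t0|t0].
  exists d => // s sd; case: ltrP => s0; last exact: hd.
  rewrite -t0 subr0 (_ : _ - _ = 0); last by ring.
  by rewrite normr0 mulr_ge0// ltW.
exists (Num.min d t); first by rewrite lt_min d0.
move=> s; rewrite lt_min => /andP[sd st]; case: ltrP => s0; last exact: hd.
by move: st; rewrite ltr_norml => /andP[]; lra.
Qed.

Lemma is_derive_continuous f t l : is_derive t 1 f l -> {for t, continuous f}.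
Proof.
by move=> [d _]; apply/differentiable_continuous/derivable1_diffP.
Qed.

Lemma antiderivative (h : R -> R) : continuous h ->
  exists H : R -> R, H 0 = 0 /\ forall t, 0 <= t -> is_derive t 1 H (h t).
Proof.
move=> ch; pose F x := \int[lebesgue_measure]_(t in `[(-1 : R), x]) h t.
exists (fun x => F x - F 0); split; first by rewrite subrr.
move=> t t0; rewrite -[h t]subr0; apply: is_deriveB.
have inth : lebesgue_measure.-integrable `[(-1 : R), t + 1] (EFin \o h).
  apply: continuous_compact_integrable; first exact: segment_compact.
  exact: continuous_subspaceT.
have tt1 : t < t + 1 by rewrite ltrDl.
have t1 : -1 < t by rewrite (lt_le_trans _ t0)// ltrN10.
have [D <-] := continuous_FTC1_closed tt1 inth t1 (ch t).
by rewrite derive1E; exact: derivableP.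
Qed.

Lemma is_derive_left_max f t l d : 0 < d -> is_derive t 1 f l ->
  (forall s, t - d < s -> s < t -> f s <= f t) -> 0 <= l.
Proof.
move=> d0 /is_deriveP D fmax; rewrite leNgt; apply/negP => l0.
have [c c0 hc] := D (- l / 2) ltac:(lra).
pose e := Num.min c d / 2.
have m0 : 0 < Num.min c d by rewrite lt_min c0.
have mc : Num.min c d <= c by rewrite ge_min lexx.
have md : Num.min c d <= d by rewrite ge_min lexx orbT.
have e0 : 0 < e by rewrite /e; lra.
have := hc (t - e); rewrite (_ : t - e - t = - e); last by ring.
rewrite normrN gtr0_norm// => /(_ ltac:(rewrite /e; lra)).
rewrite ler_norml => /andP[+ _].
have := fmax (t - e) ltac:(rewrite /e; lra) ltac:(lra).
nra.
Qed.

Lemma max_principle (I : finType) (x dx : R -> I -> R) (a c : R) :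
  (forall t i, a <= t -> is_derive t 1 (x^~ i) (dx t i)) ->
  (forall t i, a <= t -> (forall j, x t j <= x t i) -> dx t i <= 0) ->
  (forall i, x a i <= c) ->
  forall t i, a <= t -> x t i <= c.
Proof.
move=> D dx_le0 xa T i0 aT; apply/ler_addgt0Pr => e e0.
have T1 : 0 < T - a + 1 by lra.
pose eps := e / (T - a + 1); have eps0 : 0 < eps by rewrite divr_gt0.
pose y t i := x t i - eps * (t - a).
have Dy t i : a <= t -> is_derive t 1 (y^~ i) (dx t i - eps).
  move=> ta; have := D t i ta => Dt; rewrite /y.
  apply: is_deriveB; rewrite -[X in is_derive _ _ _ X]mulr1.
  have -> : (fun s => eps * (s - a)) = eps \*: (fun s : R => s - a) by [].
  by apply: is_deriveZ; rewrite -[X in is_derive _ _ _ X]subr0; exact: is_deriveB.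
have /choice[tm tmP] (i : I) : exists s, a <= s <= T /\
    forall t, a <= t <= T -> y t i <= y s i.
  have [|s] := @EVT_max R (y^~ i) a T aT.
    apply: derivable_within_continuous => t; rewrite in_itv/= => /andP[ta _].
    by case: (Dy t i ta).
  by rewrite in_itv/= => sT h; exists s; split => // t tT; apply: h; rewrite in_itv.
pose P (i : I) := true.
have [i1 _ hi1] := @arg_maxP _ _ I i0 P (fun i => y (tm i) i) isT.
have [/andP[at1 t1T] h1] := tmP i1.
have y_max t i : a <= t <= T -> y t i <= y (tm i1) i1.
  by move=> tT; have [_ /(_ t tT) h2] := tmP i; apply: le_trans h2 (hi1 i isT).
have y1c : y (tm i1) i1 <= c.
  move: at1; rewrite le_eqVlt => /predU1P[<-|at1].
    by rewrite /y subrr mulr0 subr0.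
  have : dx (tm i1) i1 <= 0.
    apply: dx_le0 => [|j]; first exact: ltW.
    by have := y_max (tm i1) j; rewrite (ltW at1) t1T => /(_ isT); rewrite /y; lra.
  suff : 0 <= dx (tm i1) i1 - eps by lra.
  apply: (@is_derive_left_max (y^~ i1) _ _ (tm i1 - a)); first by rewrite subr_gt0.
    exact/Dy/ltW.
  by move=> s s1 s2; apply: y_max; apply/andP; split; lra.
have := y_max T i0; rewrite aT lexx => /(_ isT) yT.
have : eps * (T - a) <= e.
  by rewrite /eps mulrAC ler_pdivrMr// ler_pM2l//; lra.
by move: (le_trans yT y1c); rewrite /y; lra.
Qed.

Lemma derive_le (f g df dg : R -> R) (a : R) : f a <= g a ->
  (forall t, a <= t -> is_derive t 1 f (df t)) ->
  (forall t, a <= t -> is_derive t 1 g (dg t)) ->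
  (forall t, a <= t -> df t <= dg t) ->
  forall t, a <= t -> f t <= g t.
Proof.
move=> fga Df Dg dfg t at_; rewrite -subr_le0.
apply: (@max_principle unit (fun t _ => f t - g t) (fun t _ => df t - dg t) a) => //.
- move=> s _ sa; have := Df s sa; have := Dg s sa => ? ?; exact: is_deriveB.
- by move=> s _ sa _; rewrite subr_le0 dfg.
- by rewrite subr_le0.
Qed.

End Derivatives.

(** * Ordinary differential equations with a Lipschitz vector field *)

Section Picard.
Context {R : realType}.

Lemma geometric_limit (x : nat -> R) (c : R) :
  (forall n, `|x n.+1 - x n| <= c / 2 ^+ n) ->
  exists l, forall n, `|l - x n| <= 2 * c / 2 ^+ n.
Proof.
move=> xc; have c0 : 0 <= c.
  by have := xc 0; rewrite expr0 divr1; apply: le_trans.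
pose y n := x n - 2 * c / 2 ^+ n; pose z n := x n + 2 * c / 2 ^+ n.
have half n : 2 * c / 2 ^+ n.+1 = c / 2 ^+ n.
  by rewrite exprS invfM; field; rewrite expf_neq0.
have twice n : 2 * c / 2 ^+ n = 2 * (c / 2 ^+ n) by rewrite mulrA.
have y_nd : nondecreasing_seq y.
  apply/nondecreasing_seqP => n; rewrite /y half twice.
  by have := xc n; rewrite ler_norml => /andP[? ?]; lra.
have z_ni : nonincreasing_seq z.
  apply/nonincreasing_seqP => n; rewrite /z half twice.
  by have := xc n; rewrite ler_norml => /andP[? ?]; lra.
have yz n m : y n <= z m.
  apply: le_trans (y_nd _ _ (leq_maxl n m)) _.
  apply: le_trans (z_ni _ _ (leq_maxr n m)).
  by rewrite lerD2l ge0_cp// divr_ge0// mulr_ge0.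
exists (sup (range y)) => n; rewrite ler_distl; apply/andP; split.
  apply: ub_le_sup; last by exists n.
  by exists (z 0) => _ [m _ <-].
apply: ge_sup; first by exists (y 0), 0.
by move=> _ [m _ <-]; exact: yz.
Qed.

Lemma is_derive_expRM (A k t : R) :
  is_derive t 1 (fun s => A * expR (k * s)) (A * (k * expR (k * t))).
Proof.
apply: (@is_deriveZ R R R (fun s => expR (k * s)) A).
rewrite mulrC; apply: (@is_derive1_comp R expR (fun s => k * s)).
rewrite -[X in is_derive _ _ _ X]mulr1.
exact: (@is_deriveZ R R R id k).
Qed.

Lemma norm_derive_le (f g df dg : R -> R) : `|f 0| <= g 0 ->
  (forall t : R, 0 <= t -> is_derive t 1 f (df t)) ->
  (forall t : R, 0 <= t -> is_derive t 1 g (dg t)) ->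
  (forall t : R, 0 <= t -> `|df t| <= dg t) ->
  forall t : R, 0 <= t -> `|f t| <= g t.
Proof.
rewrite ler_norml => /andP[f1 f2] Df Dg dfg t t0; rewrite ler_norml.
have {}dfg s : 0 <= s -> - dg s <= df s <= dg s.
  by move=> s0; rewrite -ler_norml dfg.
apply/andP; split.
  rewrite lerNl; apply: (@derive_le R (fun t => - f t) g
    (fun t => - df t) dg 0 _ _ _ _ t t0)
    => [|s s0|s s0].
  - by rewrite lerNl.
  - by have := Df s s0 => ?; exact: is_deriveN.
  - by rewrite lerNl; case/andP: (dfg s s0).
by apply: (@derive_le R f g df dg 0 _ _ _ _ t t0) => // s s0; case/andP: (dfg s s0).
Qed.

Context {I : finType} (G : (I -> R) -> I -> R) (L : R).
Hypothesis L_gt0 : 0 < L.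
Hypothesis G_lip : forall (u v : I -> R) (e : R),
  (forall i, `|u i - v i| <= e) -> forall i, `|G u i - G v i| <= L * e.

Let solution (u0 : I -> R) (u : R -> I -> R) :=
  (forall i, u 0 i = u0 i) /\
  forall (t : R) i, 0 <= t -> is_derive t 1 (u^~ i) (G (u t) i).

Lemma ode_unique (u0 : I -> R) (u v : R -> I -> R) :
  solution u0 u -> solution u0 v -> forall t i, 0 <= t -> u t i = v t i.
Proof.
move=> [u00 Du] [v00 Dv] t i t0.
pose sg (b : bool) : R := if b then 1 else -1.
pose x t (p : I * bool) := sg p.2 * (expR (- L * t) * (u t p.1 - v t p.1)).
pose dx t (p : I * bool) := sg p.2 *
  (expR (- L * t) * (G (u t) p.1 - G (v t) p.1 - L * (u t p.1 - v t p.1))).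
suff xle0 p : x t p <= 0.
  have e0 : 0 < expR (- L * t) by exact: expR_gt0.
  have := xle0 (i, true); have := xle0 (i, false).
  rewrite /x /sg/= mul1r mulN1r oppr_le0 pmulr_rge0// pmulr_rle0//; lra.
apply: (@max_principle R _ x dx 0 0) => //.
- move=> s [j b] s0; rewrite /x /dx/=.
  apply: (@is_deriveZ R R R (fun s => expR (- L * s) * (u s j - v s j)) (sg b)).
  have D1 : is_derive s 1 (fun s => u s j - v s j) (G (u s) j - G (v s) j).
    by have := Du s j s0; have := Dv s j s0 => ? ?; exact: is_deriveB.
  have D2 := is_derive_expRM 1 (- L) s.
  have -> : (fun s => expR (- L * s) * (u s j - v s j)) =
      (fun s => 1 * expR (- L * s)) * (fun s => u s j - v s j).
    by apply/funext => r; rewrite -[X in X * _ = _]mul1r.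
  apply: is_derive_eq; rewrite /GRing.scale/=; ring.
- move=> s [j b] s0 h; rewrite /dx/=.
  have e0 : 0 < expR (- L * s) by exact: expR_gt0.
  set w := sg b * (u s j - v s j).
  have h1 j' b' : sg b' * (u s j' - v s j') <= w.
    have := h (j', b'); rewrite /x/= ![sg _ * (expR _ * _)]mulrCA.
    by rewrite ler_pM2l.
  have h2 j' : `|u s j' - v s j'| <= w.
    by rewrite ler_norml; have := h1 j' true; have := h1 j' false; rewrite /sg; lra.
  have := G_lip _ _ _ h2 j; rewrite ler_norml.
  rewrite [X in _ -> X <= 0](_ : _ = expR (- L * s) *
      (sg b * (G (u s) j - G (v s) j) - L * w)); last by rewrite /w; ring.
  rewrite pmulr_rle0// subr_le0; move: (L * w) => Lw.
  by rewrite /sg; case: (b) => /andP[]; lra.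
- by move=> [j b]; rewrite /x u00 v00 subrr !mulr0.
Qed.

Let vector_field_continuous (u : R -> I -> R) i :
  (forall j, continuous (u^~ j)) -> continuous (fun t => G (u t) i).
Proof.
move=> uc t; apply/cvgrPdist_le => e e0.
have : \forall s \near t, forall j, `|u t j - u s j| <= e / L.
  apply: (filter_forall (nbhs_filter t)) => j.
  have /cvgrPdist_le/(_ (e / L)) := uc j t; apply.
  by rewrite divr_gt0.
by apply: filterS => s /(G_lip _ _ _)/(_ i); rewrite mulrC divfK// gt_eqF.
Qed.

Let clamp_continuous (f : R -> R) :
  (forall t : R, 0 <= t -> {for t, continuous f}) ->
  continuous (fun t : R => f (Num.max t 0)).
Proof.
move=> fc t; apply: (@continuous_comp _ _ _ (fun t : R => Num.max t 0) f).
  by apply: continuous_max; [exact: cvg_id|exact: cvg_cst].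
by apply: fc; rewrite le_max lexx orbT.
Qed.

Theorem picard_lindelof (u0 : I -> R) : exists u, solution u0 u.
Proof.
pose regular (u : R -> I -> R) := forall i, continuous (fun t : R => u (Num.max t 0) i).
pose integrates (u w : R -> I -> R) := (forall i, w 0 i = u0 i) /\
  forall (t : R) i, 0 <= t -> is_derive t 1 (w^~ i) (G (u t) i).
have integrates_regular u w : integrates u w -> regular w.
  move=> [_ D] i; apply: (@clamp_continuous (w^~ i)) => t t0.
  exact: is_derive_continuous _ _ _ (D t i t0).
have ex_integral u : exists w, regular u -> integrates u w.
  have [ru|] := pselect (regular u); last by exists u.
  have /choice[w wP] (i : I) := antiderivative _
    (@vector_field_continuous (fun t : R => u (Num.max t 0)) i ru).
  exists (fun t i => u0 i + w i t) => _; split=> [i|t i t0].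
    by have [-> _] := wP i; rewrite addr0.
  have [_ /(_ t t0)] := wP i; rewrite (max_idPl t0) => D.
  rewrite -[X in is_derive _ _ _ X]add0r; exact: is_deriveD.
have [T TP] := choice ex_integral.
pose u n := iter n T (fun=> u0).
have u_reg n : regular (u n).
  elim: n => [i t|n IHn]; first exact: cvg_cst.
  exact: integrates_regular _ _ (TP _ IHn).
have uP n : integrates (u n) (u n.+1) by exact: TP (u_reg n).
pose A := (\sum_i `|G u0 i|) / (2 * L).
have A0 : 0 <= A by rewrite divr_ge0 ?sumr_ge0// mulr_ge0// ltW.
pose E (t : R) := expR (2 * L * t).
have E_gt0 (t : R) : 0 < E t by exact: expR_gt0.
have D0 c (t : R) : is_derive t 1 (fun s => c * E s) (c * (2 * L * E t)).
  exact: is_derive_expRM.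
have u00 n i : u n 0 i = u0 i by case: n => [//|n]; have [->] := uP n.
have pow2 n : 0 < (2 : R) ^+ n by rewrite exprn_gt0.
have A2_ge0 n : 0 <= A / 2 ^+ n by rewrite divr_ge0// ltW.
have u_step n (t : R) i : 0 <= t -> `|u n.+1 t i - u n t i| <= A / 2 ^+ n * E t.
  elim: n t i => [|n IHn] t i t0.
    rewrite expr0 divr1.
    apply: (@norm_derive_le (fun t => u 1 t i - u 0 t i) (fun t => A * E t)
       (fun=> G u0 i) (fun t => A * (2 * L * E t))) => // [|s s0|s s0].
    - by rewrite !u00 subrr normr0 mulr_ge0// ltW.
    - rewrite -[G u0 i]subr0; apply: is_deriveB.
      by have [_ /(_ s i s0)] := uP 0.
      exact: is_derive_cst.
    - have -> : A * (2 * L * E s) = (\sum_i `|G u0 i|) * E s.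
        by rewrite /A; field; rewrite gt_eqF.
      rewrite (bigD1 i)//= mulrDl; apply: ler_wpDr.
        by rewrite mulr_ge0 ?sumr_ge0// ltW.
      rewrite ler_peMr// /E -expR0 ler_expR mulr_ge0// mulr_ge0// ltW//.
  apply: (@norm_derive_le (fun t => u n.+2 t i - u n.+1 t i)
     (fun t => A / 2 ^+ n.+1 * E t)
     (fun t => G (u n.+1 t) i - G (u n t) i)
     (fun t => A / 2 ^+ n.+1 * (2 * L * E t))) => // [|s s0|s s0].
  - by rewrite !u00 subrr normr0 mulr_ge0 ?A2_ge0// ltW.
  - by have [_ /(_ s i s0) ?] := uP n; have [_ /(_ s i s0) ?] := uP n.+1;
      exact: is_deriveB.
  - have := G_lip _ _ _ (fun j => IHn s j s0) i; congr (_ <= _).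
    by rewrite exprS; field; rewrite gt_eqF.
have /choice[v vP] (t : R) : exists w : I -> R, 0 <= t ->
    forall i n, `|w i - u n t i| <= 2 * A / 2 ^+ n * E t.
  have [t0|t0] := leP 0 t; last by exists u0.
  suff /choice[w wP] (i : I) : exists l, forall n,
      `|l - u n t i| <= 2 * A / 2 ^+ n * E t by exists w.
  have [n|l lP] := @geometric_limit (fun n => u n t i) (A * E t).
    by rewrite mulrAC; exact: u_step.
  exists l => n; rewrite (le_trans (lP n))// (_ : _ / _ = 2 * A / 2 ^+ n * E t)//.
  by field; rewrite gt_eqF.
have small (c e : R) : 0 < e -> exists n, c / 2 ^+ n <= e.
  move=> e0; pose n := Num.truncn (`|c| / e); exists n.+1.
  rewrite ler_pdivrMr// (le_trans (ler_norm _))// mulrC -ler_pdivrMr//.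
  have /andP[_ /ltW] := truncn_itv (divr_ge0 (normr_ge0 c) (ltW e0)).
  move=> /le_trans; apply; rewrite -natrX ler_nat ltnW// ltn_expl//.
have v_reg : regular v.
  move=> i t; apply/cvgrPdist_le => e e0.
  have [n nP] := small (2 * A * E (Num.max t 0 + 1)) (e / 3) ltac:(lra).
  have close s : s <= t + 1 -> `|v (Num.max s 0) i - u n (Num.max s 0) i| <= e / 3.
    move=> st; have s0 : 0 <= Num.max s 0 by rewrite le_max lexx orbT.
    apply: le_trans (vP _ s0 i n) _; apply: le_trans nP.
    rewrite [X in X <= _]mulrAC ler_pM2r ?invr_gt0//.
    apply: ler_wpM2l; first by apply: mulr_ge0.
    rewrite ler_expR ler_pM2l ?mulr_gt0//.
    rewrite ge_max (le_trans st) ?lerD2r ?le_max ?lexx//= ltW//.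
    by rewrite ltr_wpDl// le_max lexx orbT.
  have /cvgrPdist_le/(_ (e / 3) ltac:(lra)) := u_reg n i t.
  have : \forall s \near t, s <= t + 1.
    apply/nbhs_ballP; exists 1 => //= s; rewrite /ball/= ltr_distl => /andP[]; lra.
  apply: filterS2 => s st.
  have := close s st; have := close t ltac:(lra).
  rewrite !ler_norml => /andP[? ?] /andP[? ?] /andP[? ?].
  apply/andP; split; lra.
have [_ vD] : integrates v (T v) by exact: TP v_reg.
have Tv0 i : T v 0 i = u0 i by have [->] := TP _ v_reg.
have TvE (t : R) i : 0 <= t -> T v t i = v t i.
  move=> t0; apply/eqP; rewrite -subr_eq0 -normr_le0; apply/ler_addgt0Pr => e e0.
  have [n nP] := small (2 * A * E t) (e / 2) ltac:(lra).
  have h1 : `|T v t i - u n.+1 t i| <= A / 2 ^+ n * E t.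
    apply: (@norm_derive_le (fun t => T v t i - u n.+1 t i)
       (fun t => A / 2 ^+ n * E t)
       (fun t => G (v t) i - G (u n t) i)
       (fun t => A / 2 ^+ n * (2 * L * E t))) => // [|s s0|s s0].
    - by rewrite Tv0 u00 subrr normr0 mulr_ge0 ?A2_ge0// ltW.
    - have := vD s i s0; have [_ /(_ s i s0)] := uP n => ? ?.
      exact: is_deriveB.
    - have := G_lip _ _ _ (fun j => vP s s0 j n) i; congr (_ <= _).
      by field; rewrite gt_eqF.
  have h2 := vP t t0 i n.+1.
  have h3 : 2 * A / 2 ^+ n.+1 * E t = A / 2 ^+ n * E t.
    by rewrite exprS; field; rewrite gt_eqF.
  move: nP h1 h2; rewrite h3 (_ : 2 * A * E t / 2 ^+ n = 2 * (A / 2 ^+ n * E t)).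
    move: (A / 2 ^+ n * E t) => B ? ; rewrite add0r !ler_norml.
    move=> /andP[? ?] /andP[? ?]; apply/andP; split; lra.
  by field; rewrite gt_eqF.
exists (T v); split=> // t i t0.
by rewrite (_ : T v t = v t); [exact: vD|apply/funext => j; exact: TvE].
Qed.

End Picard.

(** * Comparison and a Harnack inequality for the flow *)

Section CycleFlow.
Context {R : realType} {k : nat}.
Implicit Types (x dx : R -> 'I_k -> R) (phi : R -> R) (i j : 'I_k).

Let flow_derivative phi (u : 'I_k -> R) i : R :=
  - min_eigen (phi (u (ordS i)))^-1 (phi (u i))^-1 (phi (u (ord_pred i)))^-1.

Lemma flow_le phi x (a c : R) : {homo phi : s t / s <= t} ->
  (forall (t : R) i, a <= t -> 0 < phi (x t i)) ->
  (forall (t : R) i, a <= t -> is_derive t 1 (x^~ i)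
    (flow_derivative phi (x t) i)) ->
  (forall i, x a i <= c) -> forall (t : R) i, a <= t -> x t i <= c.
Proof.
move=> phi_homo phi_gt0 D xa t i ta.
apply: (max_principle _ x (fun t => flow_derivative phi (x t)) a) => // s j sa jmax.
rewrite oppr_le0; apply: min_eigen_ge0; first by rewrite invr_gt0 phi_gt0.
  by rewrite lef_pV2 ?posrE ?phi_gt0 ?phi_homo.
by rewrite lef_pV2 ?posrE ?phi_gt0 ?phi_homo.
Qed.

Lemma flow_ge phi x (a c : R) : {homo phi : s t / s <= t} ->
  (forall (t : R) i, a <= t -> 0 < phi (x t i)) ->
  (forall (t : R) i, a <= t -> is_derive t 1 (x^~ i)
    (flow_derivative phi (x t) i)) ->
  (forall i, c <= x a i) -> forall (t : R) i, a <= t -> c <= x t i.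
Proof.
move=> phi_homo phi_gt0 D xa t i ta; rewrite -lerN2.
apply: (max_principle _ (fun t i => - x t i)
  (fun t i => - flow_derivative phi (x t) i) a) => // [s j sa|s j sa jmin|j].
- by have := D s j sa => ?; exact: is_deriveN.
- have {}jmin j' : x s j <= x s j' by rewrite -lerN2.
  rewrite opprK; apply: min_eigen_le0; rewrite ?invr_gt0 ?phi_gt0//.
    by rewrite lef_pV2 ?posrE ?phi_gt0 ?phi_homo.
  by rewrite lef_pV2 ?posrE ?phi_gt0 ?phi_homo.
- by rewrite lerN2.
Qed.

Lemma inv_dist_le (a y z : R) : 0 < a -> a <= y -> a <= z ->
  `|y^-1 - z^-1| <= `|y - z| / a ^+ 2.
Proof.
move=> a0 ay az; have y0 := lt_le_trans a0 ay; have z0 := lt_le_trans a0 az.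
rewrite (_ : y^-1 - z^-1 = (z - y) / (y * z)); last first.
  by field; rewrite !gt_eqF.
rewrite normrM distrC normfV ler_wpM2l// gtr0_norm ?mulr_gt0//.
by rewrite lef_pV2 ?posrE ?mulr_gt0 ?exprn_gt0// expr2 ler_pM// ltW.
Qed.

(* With p, q, r the inverse weights of the two neighbours and of the vertex and
   s the square root in [min_eigen], the right hand side is
   A * (r - p) + B * (r - q), where A = 1/2 - (p - q) / (4 * (s + r)) and
   B = 1 - A lie strictly between 0 and 1. *)
Lemma min_eigen_diffusion (a b l y z w : R) : 0 < a ->
  a <= y <= b -> a <= z <= b -> a <= w <= b -> l <= y -> l <= z -> l <= w ->
  a / (6 * b ^+ 3) * (w - l) - 2 / a ^+ 2 * (z - l) <=
  - min_eigen y^-1 z^-1 w^-1.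
Proof.
move=> a0 /andP[ay yb] /andP[az zb] /andP[aw wb] ly lz lw.
have y0 := lt_le_trans a0 ay; have z0 := lt_le_trans a0 az.
have w0 := lt_le_trans a0 aw; have b0 := lt_le_trans w0 wb.
have inv_le v : a <= v -> v^-1 <= a^-1.
  by move=> av; rewrite lef_pV2 ?posrE// (lt_le_trans a0).
have p0 : 0 < y^-1 by rewrite invr_gt0.
have q0 : 0 < w^-1 by rewrite invr_gt0.
have r0 : 0 < z^-1 by rewrite invr_gt0.
have rb : b^-1 <= z^-1 by rewrite lef_pV2 ?posrE.
have pa := inv_le y ay; have qa := inv_le w aw; have ra := inv_le z az.
rewrite /min_eigen opprB.
set p := y^-1 in p0 pa *; set q := w^-1 in q0 qa *; set r := z^-1 in r0 rb ra *.
set s := Num.sqrt _.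
have s2 : s ^+ 2 = ((p - q) / 2) ^+ 2 + r ^+ 2.
  by rewrite sqr_sqrtr// addr_ge0 ?sqr_ge0.
have s0 : 0 <= s by exact: sqrtr_ge0.
have s_ge : `|(p - q) / 2| <= s.
  by rewrite -sqrtr_sqr ler_sqrt ?lerDl ?addr_ge0 ?sqr_ge0.
have s_le : s <= 2 * a^-1.
  rewrite -(ler_pXn2r (n := 2)) ?nnegrE//; last by lra.
  rewrite s2; nra.
move: s_ge; rewrite ler_norml => /andP[s_ge1 s_ge2].
have sr0 : 0 < s + r by lra.
pose B := 1 / 2 + (p - q) / (4 * (s + r)).
have E : s - (p + q) / 2 = (1 - B) * (r - p) + B * (r - q).
  rewrite /B; have -> : s - (p + q) / 2 = (s ^+ 2 - r ^+ 2) / (s + r) + r - (p + q) / 2.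
    by field; rewrite gt_eqF.
  by rewrite s2; field; rewrite gt_eqF.
have B1 : B <= 1.
  rewrite /B -lerBrDl ler_pdivrMr; last by lra.
  lra.
have Bge : a / (6 * b) <= B.
  have -> : a / (6 * b) = b^-1 / (2 * (3 * a^-1)).
    by field; rewrite !gt_eqF.
  have -> : B = (s + r + (p - q) / 2) / (2 * (s + r)).
    by rewrite /B; field; rewrite gt_eqF.
  apply: (@le_trans _ _ (r / (2 * (s + r)))).
    rewrite ler_pM// ?invr_ge0; try lra.
    by rewrite lef_pV2 ?posrE; lra.
  by rewrite ler_pM2r ?invr_gt0; lra.
have B0 : 0 <= B by apply: le_trans Bge; rewrite divr_ge0// ?mulr_ge0// ltW.
have A2 : 0 < a ^+ 2 by rewrite exprn_gt0.
have ainv v : a <= v -> r * v^-1 <= (a ^+ 2)^-1.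
  move=> av; rewrite expr2 invfM ler_pM ?inv_le// ?ltW//.
  by rewrite invr_gt0 (lt_le_trans a0).
have rp : - ((z - l) * (a ^+ 2)^-1) <= r - p.
  have -> : r - p = (y - l) * (r * p) - (z - l) * (r * p).
    by rewrite /r /p; field; rewrite !gt_eqF.
  have h1 : (z - l) * (r * p) <= (z - l) * (a ^+ 2)^-1.
    by rewrite ler_wpM2l ?subr_ge0// ainv.
  have h2 : 0 <= (y - l) * (r * p).
    by rewrite !mulr_ge0// ?subr_ge0// ltW.
  lra.
have rq : r - q = (w - l) * (r * q) - (z - l) * (r * q).
  by rewrite /r /q; field; rewrite !gt_eqF.
have h1 : (z - l) * (r * q) <= (z - l) * (a ^+ 2)^-1.
  by rewrite ler_wpM2l ?subr_ge0// ainv.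
have h2 : (w - l) * (b ^+ 2)^-1 <= (w - l) * (r * q).
  by rewrite ler_wpM2l ?subr_ge0// expr2 invfM ler_pM ?invr_ge0 ?lef_pV2 ?posrE// ltW.
have e1 : a / (6 * b ^+ 3) * (w - l) = a / (6 * b) * ((w - l) * (b ^+ 2)^-1).
  by field; rewrite gt_eqF.
have h3 : a / (6 * b) * ((w - l) * (b ^+ 2)^-1) <= B * ((w - l) * (r * q)).
  rewrite ler_pM// ?mulr_ge0 ?subr_ge0 ?invr_ge0 ?exprn_ge0 ?mulr_ge0//; exact: ltW.
have zl : 0 <= (z - l) * (a ^+ 2)^-1.
  by rewrite divr_ge0 ?subr_ge0// ltW.
have h4 : (1 - B) * - ((z - l) * (a ^+ 2)^-1) <= (1 - B) * (r - p).
  by rewrite ler_wpM2l ?subr_ge0.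
have h5 : B * ((z - l) * (r * q)) <= B * ((z - l) * (a ^+ 2)^-1).
  by rewrite ler_wpM2l.
have e2 : 2 / a ^+ 2 * (z - l) = 2 * ((z - l) * (a ^+ 2)^-1) by ring.
have e3 : B * (r - q) = B * ((w - l) * (r * q)) - B * ((z - l) * (r * q)).
  by rewrite rq mulrBr.
rewrite E e1 e2 e3; lra.
Qed.

Lemma iter_ordS_reach i j : exists2 n, (n <= k)%N & iter n (@ordS k) i = j.
Proof.
have val_iter n : iter n (@ordS k) i = ((i + n) %% k)%N :> nat.
  elim: n => [|n IHn] /=; first by rewrite addn0 modn_small.
  by rewrite IHn -addn1 modnDml addn1 addnS.
exists (if (i <= j)%N then j - i else j + k - i)%N.
  by have := ltn_ord i; have := ltn_ord j; case: ifP; lia.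
apply/val_inj; rewrite /= val_iter.
have := ltn_ord i; have jk := ltn_ord j; case: ifP => ij ik.
  by rewrite subnKC// modn_small.
by rewrite subnKC; [rewrite modnDr modn_small|lia].
Qed.

(* Mass travels around the cycle one vertex per unit of time. *)
Lemma propagation (v dv : R -> 'I_k -> R) (a d : R) : 0 <= d <= 1 ->
  (forall (t : R) i, a <= t -> is_derive t 1 (v^~ i) (dv t i)) ->
  (forall (t : R) i, a <= t -> 0 <= v t i) ->
  (forall (t : R) i, a <= t -> d * v t (ord_pred i) <= dv t i) ->
  forall i j, d ^+ k * v a i <= v (a + k%:R) j.
Proof.
move=> /andP[d0 d1] D v0 dv_ge i j.
have v_nd (s t : R) i' : a <= s -> s <= t -> v s i' <= v t i'.
  move=> sa st; apply: (derive_le (fun=> v s i') (v^~ i') (fun=> 0) (dv^~ i') s) => //.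
    by move=> r rs; apply: D; exact: le_trans rs.
  move=> r rs; have ra := le_trans sa rs; apply: le_trans (dv_ge r i' ra).
  by rewrite mulr_ge0// v0.
have step (s : R) i' : a <= s -> d * v s i' <= v (s + 1) (ordS i').
  move=> sa; have s1 : s <= s + 1 by rewrite lerDl.
  have -> : d * v s i' = d * v s i' * (s + 1 - s) by rewrite addrAC subrr add0r mulr1.
  apply: (derive_le (fun t => d * v s i' * (t - s)) (v^~ (ordS i'))
    (fun=> d * v s i') (dv^~ (ordS i')) s) => //.
  - by rewrite subrr mulr0 v0.
  - move=> r _; rewrite -[X in is_derive _ _ _ X]mulr1.
    apply: (@is_deriveZ R R R (fun t => t - s)).
    by rewrite -[X in is_derive _ _ _ X]subr0; exact: is_deriveB.
  - by move=> r rs; apply: D; exact: le_trans rs.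
  - move=> r rs; have ra := le_trans sa rs; apply: le_trans (dv_ge r _ ra).
    by rewrite ordSK ler_wpM2l// v_nd.
have steps n : d ^+ n * v a i <= v (a + n%:R) (iter n (@ordS k) i).
  elim: n => [|n IHn]; first by rewrite mul1r addr0.
  rewrite exprS -mulrA -natr1 addrA; apply: le_trans (step _ _ _); last first.
    by rewrite lerDl.
  by rewrite ler_wpM2l.
have [n nk <-] := iter_ordS_reach i j.
apply: le_trans (le_trans (steps n) _).
  by rewrite ler_wpM2r ?v0// ler_wiXn2l.
by rewrite v_nd ?lerDl// lerD2l ler_nat.
Qed.

Lemma flow_harnack (a b : R) : 0 < a -> exists2 c : R, 0 < c &
  forall x (t0 l : R),
  (forall (t : R) i, t0 <= t -> a <= x t i <= b) ->
  (forall (t : R) i, t0 <= t -> is_derive t 1 (x^~ i)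
    (flow_derivative id (x t) i)) ->
  (forall i, l <= x t0 i) ->
  forall i j, c * (x t0 i - l) <= x (t0 + k%:R) j - l.
Proof.
move=> a0; have [ab|ba] := leP a b; last first.
  exists 1 => // x t0 l box _ _ i; have /andP[h1 h2] := box t0 i (lexx _); lra.
have b0 := lt_le_trans a0 ab.
pose d := Num.min (a / (6 * b ^+ 3)) 1; pose E := 2 / a ^+ 2.
have d0 : 0 < d by rewrite lt_min ltr01 divr_gt0 ?mulr_gt0 ?exprn_gt0.
have d1 : d <= 1 by rewrite ge_min lexx orbT.
exists (d ^+ k / expR (E * k%:R)); first by rewrite divr_gt0 ?exprn_gt0 ?expR_gt0.
move=> x t0 l box D xl i j.
have x_pos (t : R) i' : t0 <= t -> 0 < x t i'.
  by move=> tt0; case/andP: (box t i' tt0) => /(lt_le_trans a0).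
have x_ge (t : R) i' : t0 <= t -> l <= x t i'.
  by apply: (flow_ge id x t0 l).
pose v (t : R) i' := expR (E * t) * (x t i' - l).
pose dv (t : R) i' :=
  expR (E * t) * (flow_derivative id (x t) i' + E * (x t i' - l)).
have := @propagation v dv t0 d _ _ _ _ i j; rewrite (ltW d0) d1 => /(_ isT).
have Dv (t : R) i' : t0 <= t -> is_derive t 1 (v^~ i') (dv t i').
  move=> tt0; have D1 := D t i' tt0; have D2 := is_derive_expRM 1 E t.
  have -> : v^~ i' = (fun s => 1 * expR (E * s)) * (fun s => x s i' - l).
    by apply/funext => s; rewrite /v -[X in X * _ = _]mul1r.
  have D3 : is_derive t 1 (fun s => x s i' - l) (flow_derivative id (x t) i').
    by rewrite -[flow_derivative _ _ _]subr0; apply: is_deriveB.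
  by apply: is_derive_eq; rewrite /dv /GRing.scale/=; ring.
have v_ge0 (t : R) i' : t0 <= t -> 0 <= v t i'.
  by move=> tt0; rewrite mulr_ge0 ?expR_ge0// subr_ge0 x_ge.
have dv_ge (t : R) i' : t0 <= t -> d * v t (ord_pred i') <= dv t i'.
  move=> tt0; rewrite /v mulrCA ler_pM2l ?expR_gt0// -lerBlDr.
  apply: le_trans (min_eigen_diffusion a b l _ _ _ a0 _ _ _ _ _ _);
    rewrite ?box ?x_ge//.
  by rewrite lerD2r ler_wpM2r ?subr_ge0 ?x_ge// ge_min lexx.
move=> /(_ Dv v_ge0 dv_ge).
rewrite /v [E * (_ + _)]mulrDr expRD mulrCA.
rewrite -[X in _ <= X]mulrA ler_pM2l ?expR_gt0// => le_prop.
by rewrite mulrAC ler_pdivrMr ?expR_gt0// [X in _ <= X]mulrC.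
Qed.

Lemma flow_converges x (a b : R) : (0 < k)%N -> 0 < a ->
  (forall (t : R) i, 0 <= t -> a <= x t i <= b) ->
  (forall (t : R) i, 0 <= t -> is_derive t 1 (x^~ i)
    (flow_derivative id (x t) i)) ->
  exists2 c : R, 0 < c & forall i, x t i @[t --> +oo] --> c.
Proof.
move=> k0 a0 box D; pose i0 := Ordinal k0.
have [c c0 harnack] := flow_harnack a b a0.
pose mu (t : R) := x (Num.max t 0) [arg min_(i < i0) x (Num.max t 0) i]%O.
have mu_le (t : R) i : mu t <= x (Num.max t 0) i.
  by rewrite /mu; case: arg_minP => // j _ /(_ i isT).
have max0 (t : R) : 0 <= Num.max t 0 by rewrite le_max lexx orbT.
have mu_nd : {homo mu : s t / s <= t}.
  move=> s t st; apply: (flow_ge id x (Num.max s 0)) => //.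
  - move=> r j rs; have r0 := le_trans (max0 s) rs.
    by case/andP: (box r j r0) => /(lt_le_trans a0).
  - by move=> r j rs; apply: D; exact: le_trans rs.
  - by rewrite ge_max !le_max st lexx orbT.
have mu_ge t : a <= mu t.
  by case/andP: (box _ [arg min_(i < i0) x (Num.max t 0) i]%O (max0 t)).
have mu_ub : has_ubound (range mu).
  exists b => _ [t _ <-].
  by case/andP: (box _ [arg min_(i < i0) x (Num.max t 0) i]%O (max0 t)).
have mu_cvg := nondecreasing_cvgr mu_nd mu_ub.
exists (sup (range mu)).
  by apply: lt_le_trans a0 (le_trans (mu_ge 0) _); apply: ub_le_sup => //; exists 0.
move=> i; set c' := sup _ in mu_cvg *.
have mu_shift : mu (t + k%:R) @[t --> +oo] --> c'.
  apply: cvg_comp mu_cvg; apply/cvgryPge => A.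
  by near=> t; rewrite -lerBlDr; near: t; apply: nbhs_pinfty_ge; exact: num_real.
apply: (@squeeze_cvgr _ _ _ _ mu
  (fun t => mu t + (mu (t + k%:R) - mu t) / c)) => //.
  near=> t; have t0 : 0 <= t by near: t; apply: nbhs_pinfty_ge; exact: num_real.
  have := mu_le t i; rewrite (max_idPl t0) => -> /=.
  rewrite -lerBlDl ler_pdivlMr// mulrC /mu.
  rewrite (@max_idPl _ _ (t + k%:R) 0 _); last by rewrite addr_ge0.
  apply: harnack => [s j st|s j st|j].
  - exact: box (le_trans t0 st).
  - exact: D (le_trans t0 st).
  - by have := mu_le t j; rewrite /mu (max_idPl t0).
rewrite -[X in _ --> X]addr0 -(mul0r c^-1) -[X in _ + X * _](subrr c').
by apply: cvgD => //; apply: cvgMr_tmp; exact: cvgB.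
Unshelve. all: by end_near.
Qed.

End CycleFlow.

(** * The flow of a clamped vector field *)

Section Clamp.
Context {R : realType} (a b : R).
Hypothesis a_gt0 : 0 < a.

Definition clamp (s : R) : R := Num.max a (Num.min s b).

Lemma clamp_ge s : a <= clamp s.
Proof. by rewrite le_max lexx. Qed.

Lemma clamp_gt0 s : 0 < clamp s.
Proof. exact: lt_le_trans a_gt0 (clamp_ge s). Qed.

Lemma clamp_id s : a <= s <= b -> clamp s = s.
Proof. by move=> /andP[sa sb]; rewrite /clamp (min_idPl sb) (max_idPr sa). Qed.

Lemma clamp_homo : {homo clamp : s t / s <= t}.
Proof.
move=> s t st; rewrite /clamp ge_max le_max lexx/= le_max; apply/orP; right.
by rewrite le_min !ge_min st lexx orbT.
Qed.

Lemma clamp_lip s t : `|clamp s - clamp t| <= `|s - t|.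
Proof.
wlog st : s t / s <= t.
  by have [st|/ltW ts] := leP s t; [apply|rewrite distrC (distrC s); apply].
have cst := clamp_homo _ _ st.
rewrite !ler0_norm ?subr_le0// !opprB.
rewrite /clamp; case: (leP s b) => sb; case: (leP t b) => tb; last lra.
- by case: (leP a s) => ?; case: (leP a t) => ?; lra.
- by case: (leP a s) => ?; case: (leP a b) => ?; lra.
- lra.
Qed.

End Clamp.

Section ClampedField.
Context {R : realType} {k : nat} (a b : R).
Hypothesis a_gt0 : 0 < a.

Definition clamped_field (u : 'I_k -> R) (i : 'I_k) : R :=
  - min_eigen (clamp a b (u (ordS i)))^-1 (clamp a b (u i))^-1
              (clamp a b (u (ord_pred i)))^-1.

Lemma clamped_field_lip (u v : 'I_k -> R) (e : R) :
  (forall i, `|u i - v i| <= e) ->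
  forall i, `|clamped_field u i - clamped_field v i| <= 3 / a ^+ 2 * e.
Proof.
move=> uve i.
have inv_le j : `|(clamp a b (u j))^-1 - (clamp a b (v j))^-1| <= e / a ^+ 2.
  apply: le_trans (inv_dist_le a _ _ a_gt0 (clamp_ge a b _) (clamp_ge a b _)) _.
  rewrite ler_pM2r ?invr_gt0 ?exprn_gt0//.
  by apply: le_trans (uve j); exact: clamp_lip.
rewrite /clamped_field opprK addrC.
set p := (clamp a b (u (ordS i)))^-1; set p' := (clamp a b (v (ordS i)))^-1.
set r := (clamp a b (u i))^-1; set r' := (clamp a b (v i))^-1.
set q := (clamp a b (u (ord_pred i)))^-1.
set q' := (clamp a b (v (ord_pred i)))^-1.
have hp : `|p - p'| <= e / a ^+ 2 := inv_le (ordS i).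
have hr : `|r - r'| <= e / a ^+ 2 := inv_le i.
have hq : `|q - q'| <= e / a ^+ 2 := inv_le (ord_pred i).
have -> : 3 / a ^+ 2 * e = 3 * (e / a ^+ 2) by rewrite mulrAC mulrA.
have := min_eigen_lip p r q p' r' q'; have := min_eigen_lip p' r' q' p r q.
rewrite (distrC p') (distrC q') (distrC r') => h1 h2.
by rewrite ler_norml; apply/andP; split; lra.
Qed.

Lemma clamped_field_id (u : 'I_k -> R) i : (5 <= k)%N ->
  (forall j, a <= u j <= b) -> clamped_field u i = - Ric (@cycle_adj k) u i.
Proof.
move=> k5 box; rewrite /clamped_field !clamp_id// Ric_cycle// => j.
by case/andP: (box j) => /(lt_le_trans a_gt0).
Qed.

End ClampedField.

Lemma Ricci_flow_solution (R : realType) (k : nat) (m0 : 'I_k -> R)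
    (m : R -> 'I_k -> R) (a b : R) : (5 <= k)%N -> 0 < a ->
  (forall i, a <= m0 i <= b) ->
  Ricci_flow (@cycle_adj k) m0 m ->
  exists u : R -> 'I_k -> R,
  [/\ forall (t : R) i, 0 <= t -> u t i = m t i,
      forall i, u 0 i = m0 i,
      forall (t : R) i, 0 <= t -> a <= u t i <= b
    & forall (t : R) i, 0 <= t ->
    is_derive t 1 (u^~ i) (- Ric (@cycle_adj k) (u t) i)].
Proof.
move=> k5 a0 box0 [m_gt0 m_0 m_deriv].
pose u (t : R) i := tangent_extension (m^~ i) (- Ric (@cycle_adj k) (m 0) i) t.
have uE (t : R) i : 0 <= t -> u t i = m t i.
  by move=> t0; rewrite /u /tangent_extension ltNge t0.
have umE (t : R) : 0 <= t -> u t = m t.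
  by move=> t0; apply/funext => i; exact: uE.
have Du (t : R) i : 0 <= t ->
    is_derive t 1 (u^~ i) (- Ric (@cycle_adj k) (u t) i).
  move=> t0; rewrite umE//.
  apply: (tangent_extension_derive (m^~ i)
    (fun t => - Ric (@cycle_adj k) (m t) i)) => //.
  by move=> s s0; exact: m_deriv.
have u_gt0 (t : R) i : 0 <= t -> 0 < u t i.
  by move=> t0; rewrite uE// m_gt0.
have Du' (t : R) i : 0 <= t -> is_derive t 1 (u^~ i)
    (- min_eigen (id (u t (ordS i)))^-1 (id (u t i))^-1 (id (u t (ord_pred i)))^-1).
  by move=> t0; have := Du t i t0; rewrite Ric_cycle// => j; exact: u_gt0.
exists u; split => // [i|t i t0]; first by rewrite uE// m_0.
apply/andP; split.
  apply: (flow_ge id u 0) => // j; first by rewrite uE// m_0; case/andP: (box0 j).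
by apply: (flow_le id u 0) => // j; rewrite uE// m_0; case/andP: (box0 j).
Qed.

Theorem theorem3p11 (R : realType) (k : nat) (hk : (5 <= k)%N)
    (m0 : 'I_k -> R) (m0_gt0 : forall i, 0 < m0 i) :
  exists m : R -> 'I_k -> R,
    [/\ Ricci_flow (@cycle_adj k) m0 m,
        forall m' : R -> 'I_k -> R, Ricci_flow (@cycle_adj k) m0 m' ->
          forall (t : R) i, 0 <= t -> m' t i = m t i
      & exists2 c : R, 0 < c & forall i, m t i @[t --> +oo] --> c].
Proof.
have k0 : (0 < k)%N by lia.
pose i0 := Ordinal k0.
pose a := m0 [arg min_(i < i0) m0 i]%O; pose b := m0 [arg max_(i > i0) m0 i]%O.
have a0 : 0 < a by exact: m0_gt0.
have box0 i : a <= m0 i <= b.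
  rewrite /a /b; case: arg_minP => // j _ /(_ i isT) ->.
  by case: arg_maxP => // j' _ /(_ i isT).
have L0 : 0 < 3 / a ^+ 2 by rewrite divr_gt0// exprn_gt0.
have lip := @clamped_field_lip R k a b a0.
have [m [m_0 Dm]] := picard_lindelof (clamped_field a b) _ L0 lip m0.
have box (t : R) i : 0 <= t -> a <= m t i <= b.
  move=> t0; apply/andP; split.
    apply: (flow_ge (clamp a b) m 0) => // [|s j _|j].
    - exact: clamp_homo.
    - exact: clamp_gt0.
    - by rewrite m_0; case/andP: (box0 j).
  apply: (flow_le (clamp a b) m 0) => // [|s j _|j].
  - exact: clamp_homo.
  - exact: clamp_gt0.
  - by rewrite m_0; case/andP: (box0 j).
have m_gt0 (t : R) i : 0 <= t -> 0 < m t i.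
  by move=> /box => /(_ i) /andP[/(lt_le_trans a0)].
have DmRic (t : R) i : 0 <= t ->
    is_derive t 1 (m^~ i) (- Ric (@cycle_adj k) (m t) i).
  by move=> t0; rewrite -(clamped_field_id a b)//; [exact: Dm|move=> j; exact: box].
exists m; split.
- split=> // t i t0; apply: is_derive_cvg_quotient; exact: DmRic.
- move=> m' flow t i t0.
  have [u [<-// u0 ubox Du]] := Ricci_flow_solution _ _ _ _ a b hk a0 box0 flow.
  apply: (ode_unique (clamped_field a b) _ lip m0) => //; split=> // s j s0.
  by rewrite clamped_field_id//; [exact: Du|move=> ?; exact: ubox].
- apply: (flow_converges m a b) => // t i t0.
  by have := DmRic t i t0; rewrite Ric_cycle// => j; exact: m_gt0.
Qed.
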